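(* Let $q=3$. Under $G_3$ there are exactly $7$ line orbits, namely: $\mathcal L_1=\{\text{RC-lines}\}$ (size $6$); $\mathcal L_2=\text{En}\Gamma_2$ (size $12$); $\mathcal L_3=\{\text{Tr-lines}\}\cup\text{Un}\Gamma_2$ (size $4+12=16$); $\mathcal L_4=\{\text{IC-lines}\}\cup\{\mathcal A\}\cup\text{EA}_2$ (size $3+1+4=8$); $\mathcal L_5=\{\text{U}\Gamma\text{-lines}\}\cup\text{Un}\Gamma_1$ (size $12+12=24$); $\mathcal L_6=\text{EA}_1\cup\text{En}\Gamma_1$ (size $24+24=48$); $\mathcal L_7=\text{EA}_3\cup\text{En}\Gamma_3$ (size $4+12=16$).
   Context: Notation. $\mathbb F_q$ is the field with $q$ elements, $\mathbb F_q^+=\mathbb F_q\cup\{\infty\}$. Points of $\mathrm{PG}(3,q)$ are written $\mathbf P(x_0,x_1,x_2,x_3)$ with $x$ a nonzero row vector up to scalars; $\boldsymbol\pi(c_0,c_1,c_2,c_3)$ is the plane $c_0x_0+c_1x_1+c_2x_2+c_3x_3=0$. Put $P(t)=\mathbf P(t^3,t^2,t,1)$ for $t\in\mathbb F_q$, $P(\infty)=\mathbf P(1,0,0,0)$, and $\mathscr C=\{P(t):t\in\mathbb F_q^+\}$ (the twisted cubic). The osculating planes are $\pi_{\rm osc}(t)=\boldsymbol\pi(1,-3t,3t^2,-t^3)$ ($t\in\mathbb F_q$) and $\pi_{\rm osc}(\infty)=\boldsymbol\pi(0,0,0,1)$; these $q+1$ planes are called $\Gamma$-planes. The tangent at $P(t)$,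 $t\in\mathbb F_q$, is the line through $P(t)$ and $\mathbf P(3t^2,2t,1,0)$; the tangent at $P(\infty)$ is the line through $\mathbf P(1,0,0,0)$ and $\mathbf P(0,1,0,0)$. A real chord is a line through two distinct points of $\mathscr C$. For $\alpha\in\mathbb F_{q^2}\setminus\mathbb F_q$, the line of $\mathrm{PG}(3,q^2)$ through $P(\alpha),P(\alpha^q)$ is defined over $\mathbb F_q$, and the corresponding line of $\mathrm{PG}(3,q)$ is an imaginary chord. A unisecant is a line meeting $\mathscr C$ in exactly one point; an external line is a line disjoint from $\mathscr C$. $G_q$ is the group of all projectivities of $\mathrm{PG}(3,q)$ mapping $\mathscr C$ onto itself. For $a,b,c,d\in\mathbb F_q$, $ad-bc\ne0$, let $$M(a,b,c,d)=\begin{pmatrix} a^3&a^2c&ac^2&c^3\\ 3a^2b&a^2d+2abc&bc^2+2acd&3c^2d\\ 3ab^2&b^2c+2abd&ad^2+2bcd&3cd^2\\ b^3&b^2d&bd^2&d^3\end{pmatrix};$$ the projectivities $\mathbf P(x)\mapsto\mathbf P(xM(a,b,c,d))$ form the subgroup $G_q^*\cong PGL(2,q)$ of $G_q$ (critical subgroup). For $q=3$ all four $\Gamma$-planes contain the line $\mathcal A:\ x_0=x_3=0$, called the Ar-line. Line types for $q=3$: RC = real chord; Tr = tangent; IC = imaginary chord; Ar = the line $\mathcal A$; U$\Gamma$ = unisecant which is not a tangent and is contained in some $\Gamma$-plane; Un$\Gamma$ = unisecant contained in no $\Gamma$-plane; EA = external line different from $\mathcal A$ meeting $\mathcal A$;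 En$\Gamma$ = external line not meeting $\mathcal A$ which is not an imaginary chord. Sub-types (these sets are $G_3^*$-orbits): Un$\Gamma_1$ = the $G_3^*$-orbit of the line $\{x_1=-x_2,\ x_1=-x_3\}$ (12 lines); Un$\Gamma_2$ = the $G_3^*$-orbit of the line $\{x_2=0,\ x_1=-x_3\}$ (12 lines); EA$_2$ = the $G_3^*$-orbit of $\{x_0=0,\ x_1=-x_3\}$ (4 lines); EA$_3$ = the $G_3^*$-orbit of $\{x_0=x_2,\ x_3=0\}$ (4 lines); EA$_1$ = the remaining $24$ EA-lines; En$\Gamma_3$ = the $G_3^*$-orbit of $\{x_0=x_2,\ x_1=-x_3\}$ (12 lines); the remaining En$\Gamma$-lines form two $G_3^*$-orbits, En$\Gamma_2$ of size $12$ and En$\Gamma_1$ of size $24$. *)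

(* Defs.v *)
From HB Require Import structures.
From mathcomp Require Import all_boot all_order all_algebra all_field.
Set Implicit Arguments. Unset Strict Implicit. Unset Printing Implicit Defensive.
Import Order.TTheory GRing.Theory.
Local Open Scope ring_scope.

Notation F := ('F_3 : finFieldType).
Notation vec := ('rV[F]_4).

Definition mkv (a b c d : F) : vec :=
  \row_(j < 4) [:: a; b; c; d]`_j.

(* Subspaces of F^4 are represented as sets of vectors (containing 0).
   A projective point is a 1-dim subspace, a line a 2-dim subspace,
   a plane a 3-dim subspace; incidence is inclusion. *)
Definition crd (x : vec) (k : nat) : F := x 0 (inord k).

Definition span1 (u : vec) : {set vec} := [set x : vec | (x <= u)%MS].
Definition span2 (u v : vec) : {set vec} := [set x : vec | (x <= col_mx u v)%MS].

Definition is_line (L : {set vec}) : bool :=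
  [exists u : vec, exists v : vec,
     (\rank (col_mx u v) == 2)%N && (L == span2 u v)].

Definition lines : {set {set vec}} := [set L | is_line L].

Definition plane (c : vec) : {set vec} := [set x : vec | (x *m c^T) == 0].

Definition meets (A B : {set vec}) : bool := [exists x in A :&: B, x != 0].

(* F^+ = F ∪ {∞} is represented by option F, None = ∞ *)
Definition Pt (t : option F) : vec :=
  match t with
  | Some t => mkv (t ^+ 3) (t ^+ 2) t 1
  | None => mkv 1 0 0 0
  end.

Definition Cpts : {set {set vec}} := [set span1 (Pt t) | t : option F].

Definition osc (t : option F) : {set vec} :=
  match t with
  | Some t => plane (mkv 1 (- (3%:R * t)) (3%:R * t ^+ 2) (- t ^+ 3))
  | None => plane (mkv 0 0 0 1)
  end.

Definition Gamma_planes : {set {set vec}} := [set osc t | t : option F].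

Definition tandir (t : option F) : vec :=
  match t with
  | Some t => mkv (3%:R * t ^+ 2) (2%:R * t) 1 0
  | None => mkv 0 1 0 0
  end.

Definition act (M : 'M[F]_4) (S : {set vec}) : {set vec} := [set x *m M | x in S].

(* G_3 : projectivities (represented by invertible matrices, x |-> x M)
   mapping the twisted cubic onto itself *)
Definition G3 : {set 'M[F]_4} :=
  [set M : 'M[F]_4 | (M \in unitmx) && ([set act M P | P in Cpts] == Cpts)].

Definition Morb (L : {set vec}) : {set {set vec}} := [set act M L | M in G3].

Definition line_orbits : {set {set {set vec}}} := [set Morb L | L in lines].

Definition Mabcd (a b c d : F) : 'M[F]_4 :=
  \matrix_(i < 4, j < 4)
    (nth [::] [:: [:: a^+3; a^+2*c; a*c^+2; c^+3];
        [:: 3%:R*a^+2*b; a^+2*d + 2%:R*a*b*c; b*c^+2 + 2%:R*a*c*d; 3%:R*c^+2*d];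
        [:: 3%:R*a*b^+2; b^+2*c + 2%:R*a*b*d; a*d^+2 + 2%:R*b*c*d; 3%:R*c*d^+2];
        [:: b^+3; b^+2*d; b*d^+2; d^+3] ] i)`_j.

Definition Gstar : {set 'M[F]_4} :=
  [set Mabcd m.1.1.1 m.1.1.2 m.1.2 m.2 |
     m in [set m : F * F * F * F | m.1.1.1 * m.2 - m.1.1.2 * m.1.2 != 0]].

Definition Sorb (L : {set vec}) : {set {set vec}} := [set act M L | M in Gstar].

Lemma prime3 : prime 3. Proof. by []. Qed.
Lemma lt0_2 : (0 < 2)%N. Proof. by []. Qed.
Definition F9 : finFieldType := s2val (pPrimePowerField prime3 lt0_2).
Definition to9 (x : F) : F9 := (nat_of_ord x)%:R.
Definition Pt9 (a : F9) : 'rV[F9]_4 :=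
  \row_(j < 4) [:: a ^+ 3; a ^+ 2; a; 1]`_j.

Definition npts (L : {set vec}) : nat := #|[set P in Cpts | P \subset L]|.

Definition RC (L : {set vec}) : bool :=
  [exists s : option F, exists t : option F, (s != t) && (L == span2 (Pt s) (Pt t))].

Definition Tr (L : {set vec}) : bool :=
  [exists t : option F, L == span2 (Pt t) (tandir t)].

(* the F_3-line L whose extension to PG(3,9) is the line through
   P(alpha), P(alpha^3), alpha in F_9 \ F_3 *)
Definition IC (L : {set vec}) : bool :=
  [exists u : vec, exists v : vec, exists a : F9,
    [&& (\rank (col_mx u v) == 2)%N, L == span2 u v, a ^+ 3 != a &
        (col_mx (map_mx to9 u) (map_mx to9 v) == col_mx (Pt9 a) (Pt9 (a ^+ 3)))%MS]].

Definition Aline : {set vec} := [set x : vec | (crd x 0 == 0) && (crd x 3 == 0)].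

Definition unisecant (L : {set vec}) : bool := npts L == 1%N.
Definition external (L : {set vec}) : bool := npts L == 0%N.
Definition in_Gamma (L : {set vec}) : bool := [exists p in Gamma_planes, L \subset p].

Definition UG (L : {set vec}) : bool := [&& unisecant L, ~~ Tr L & in_Gamma L].
Definition UnG (L : {set vec}) : bool := unisecant L && ~~ in_Gamma L.
Definition EA (L : {set vec}) : bool := [&& external L, L != Aline & meets L Aline].
Definition EnG (L : {set vec}) : bool := [&& external L, ~~ meets L Aline & ~~ IC L].

Definition RC_lines : {set {set vec}} := [set L in lines | RC L].
Definition Tr_lines : {set {set vec}} := [set L in lines | Tr L].
Definition IC_lines : {set {set vec}} := [set L in lines | IC L].
Definition UG_lines : {set {set vec}} := [set L in lines | UG L].
Definition UnG_lines : {set {set vec}} := [set L in lines | UnG L].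
Definition EA_lines : {set {set vec}} := [set L in lines | EA L].
Definition EnG_lines : {set {set vec}} := [set L in lines | EnG L].

Definition UnG1 := Sorb [set x : vec | (crd x 1 == - crd x 2) && (crd x 1 == - crd x 3)].
Definition UnG2 := Sorb [set x : vec | (crd x 2 == 0) && (crd x 1 == - crd x 3)].
Definition EA2 := Sorb [set x : vec | (crd x 0 == 0) && (crd x 1 == - crd x 3)].
Definition EA3 := Sorb [set x : vec | (crd x 0 == crd x 2) && (crd x 3 == 0)].
Definition EA1 := EA_lines :\: (EA2 :|: EA3).
Definition EnG3 := Sorb [set x : vec | (crd x 0 == crd x 2) && (crd x 1 == - crd x 3)].
(* the remaining EnGamma-lines form two G_3^*-orbits, of sizes 24 and 12 *)
Definition EnG2 := [set L in EnG_lines :\: EnG3 | #|Sorb L| == 12%N].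
Definition EnG1 := [set L in EnG_lines :\: EnG3 | #|Sorb L| == 24%N].

(* Main.v *)
(** For q = 3 the cubic has only four points and these form a basis of F_3^4, so
    G_3 consists of the 384 matrices which are monomial in that basis. The 130
    lines, written as reduced pairs of vectors over {0, 1, -1}, and the images of
    one representative per class under the 384 matrices are enumerated; each class
    turns out to be the orbit of its representative.

    Only the imaginary chords need an argument. An element [a] of F_9 \ F_3 is a
    root of one of X^2 + 1, X^2 - X - 1, X^2 + X - 1; if a^2 = s a + n, then
    (a^3, a^2, a, 1) is a combination a u + v of two vectors u, v over F_3
    depending only on s and n, and likewise for its conjugate. *)
Require Import Defs.
From HB Require Import structures.
From mathcomp Require Import all_boot all_order all_algebra all_field.
From mathcomp Require Import ring.
Set Implicit Arguments. Unset Strict Implicit. Unset Printing Implicit Defensive.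
Import GRing.Theory.
Local Open Scope ring_scope.

(** * Scalars, vectors and matrices over F_3 *)

(* Computable model: [dz], [dv], [dm], [dl], [dls] decode scalars, vectors, matrices, lines
   and lists of lines; [ez], [ev], [em] encode; [mRC], [mTr], [mG3] etc. are the computable
   counterparts of [RC], [Tr], [G3] etc. *)
Definition trit := option bool.
Definition v4 : eqType := (trit * trit * trit * trit)%type.
Definition ln : eqType := (v4 * v4)%type.
Definition m4 : eqType := (v4 * v4 * v4 * v4)%type.

Notation I3 := (Some true : trit).
Notation J3 := (Some false : trit).

Definition dz (a : trit) : F := if a is Some b then if b then 1 else -1 else 0.
Definition ez (x : F) : trit := if x == 0 then None else Some (x == 1).

Lemma dzK : cancel dz ez. Proof. by case=> [[]|]. Qed.

Lemma ezK : cancel ez dz.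
Proof. by case=> [[|[|[|//]]] lt_i3]; apply/val_inj. Qed.

Definition opz (a : trit) : trit := omap negb a.
(** The Boolean of a nonzero scalar is its sign, so a product is positive exactly when the signs
    agree. In [addz], equal signs give the opposite one because 1 + 1 = -1. *)
Definition mulz (a b : trit) : trit :=
  match a, b with
  | Some a, Some b => Some (a == b)
  | _, _ => None
  end.
Definition addz (a b : trit) : trit :=
  match a, b with
  | None, _ => b
  | _, None => a
  | Some a, Some b => if a == b then Some (~~ a) else None
  end.

Lemma dzN a : dz (opz a) = - dz a.
Proof. by case: a => [[]|]; apply/val_inj. Qed.
Lemma dzM a b : dz (mulz a b) = dz a * dz b.
Proof. by case: a b => [[]|] [[]|]; apply/val_inj. Qed.
Lemma dzD a b : dz (addz a b) = dz a + dz b.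
Proof. by case: a b => [[]|] [[]|]; apply/val_inj. Qed.

Arguments opz : simpl never.
Arguments mulz : simpl never.
Arguments addz : simpl never.

Definition get (w : v4) (k : nat) : trit :=
  let: (a, b, c, d) := w in
  match k with 0 => a | 1 => b | 2 => c | _ => d end.
Definition add4 (v w : v4) : v4 :=
  let: (a, b, c, d) := v in let: (a', b', c', d') := w in
  (addz a a', addz b b', addz c c', addz d d').
Definition scale4 (k : trit) (w : v4) : v4 :=
  let: (a, b, c, d) := w in (mulz k a, mulz k b, mulz k c, mulz k d).
Definition zero4 : v4 := (None, None, None, None).
Definition mul4 (w : v4) (m : m4) : v4 :=
  let: (a, b, c, d) := w in let: (r0, r1, r2, r3) := m in
  add4 (add4 (scale4 a r0) (scale4 b r1)) (add4 (scale4 c r2) (scale4 d r3)).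
Definition mulm (m m' : m4) : m4 :=
  let: (r0, r1, r2, r3) := m in
  (mul4 r0 m', mul4 r1 m', mul4 r2 m', mul4 r3 m').
Definition id4 : m4 :=
  ((I3, None, None, None), (None, I3, None, None),
   (None, None, I3, None), (None, None, None, I3)).

Definition dv (w : v4) : vec :=
  let: (a, b, c, d) := w in mkv (dz a) (dz b) (dz c) (dz d).
Definition ev (x : vec) : v4 := (ez (crd x 0), ez (crd x 1), ez (crd x 2), ez (crd x 3)).
Arguments dv : simpl never.
Arguments ev : simpl never.

Definition row4 (m : m4) (k : nat) : v4 :=
  let: (r0, r1, r2, r3) := m in
  match k with 0 => r0 | 1 => r1 | 2 => r2 | _ => r3 end.
Definition dm (m : m4) : 'M[F]_4 := \matrix_(i < 4) dv (row4 m i).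
Definition em (M : 'M[F]_4) : m4 :=
  (ev (row (inord 0) M), ev (row (inord 1) M), ev (row (inord 2) M), ev (row (inord 3) M)).

Lemma crd_mkv a b c d k : (k < 4)%N -> crd (mkv a b c d) k = [:: a; b; c; d]`_k.
Proof. by move=> lt_k4; rewrite /crd mxE inordK. Qed.

Lemma crd_dv w k : (k < 4)%N -> crd (dv w) k = dz (get w k).
Proof. by case: w => [[[a b] c] d] lt_k4; rewrite crd_mkv //; case: k lt_k4 => [|[|[|[|]]]]. Qed.

Lemma dvK : cancel dv ev.
Proof. by case=> [[[a b] c] d]; rewrite /ev !crd_dv //= !dzK. Qed.

Lemma evK : cancel ev dv.
Proof.
move=> x; apply/rowP => j; rewrite mxE !ezK /crd.
by case: j => [[|[|[|[|//]]]] lt_j4] /=; congr (x 0 _); apply/val_inj; rewrite /= inordK.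
Qed.

Lemma dv_inj : injective dv. Proof. exact: can_inj dvK. Qed.

Lemma dv0 : dv zero4 = 0.
Proof. by apply/rowP => j; rewrite !mxE; case: j => [[|[|[|[|//]]]] lt_j4]. Qed.

Lemma dvD v w : dv (add4 v w) = dv v + dv w.
Proof.
case: v w => [[[a b] c] d] [[[a' b'] c'] d']; apply/rowP => j.
by rewrite !mxE !dzD; case: j => [[|[|[|[|//]]]] lt_j4].
Qed.

Lemma dvZ k w : dv (scale4 k w) = dz k *: dv w.
Proof.
case: w => [[[a b] c] d]; apply/rowP => j.
by rewrite !mxE !dzM; case: j => [[|[|[|[|//]]]] lt_j4].
Qed.

Lemma dv_mul w m : dv (mul4 w m) = dv w *m dm m.
Proof.
case: w m => [[[a b] c] d] [[[r0 r1] r2] r3].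
rewrite mulmx_sum_row !big_ord_recl big_ord0 !rowK addr0 !mxE /= addrA.
by rewrite !dvD !dvZ addrA.
Qed.

Lemma dm_mul m m' : dm (mulm m m') = dm m *m dm m'.
Proof.
case: m => [[[r0 r1] r2] r3]; apply/row_matrixP => i; rewrite row_mul !rowK -dv_mul.
by case: i => [[|[|[|[|//]]]] lt_i4].
Qed.

Lemma dm1 : dm id4 = 1%:M.
Proof.
apply/matrixP => i j; rewrite !mxE.
case: i => [[|[|[|[|//]]]] lt_i4]; rewrite !mxE.
all: by case: j => [[|[|[|[|//]]]] lt_j4].
Qed.

Lemma emK : cancel em dm.
Proof.
move=> M; apply/row_matrixP => i; rewrite rowK.
case: i => [[|[|[|[|//]]]] lt_i4] /=; rewrite evK; congr (row _ M).
all: by apply/val_inj; rewrite /= inordK.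
Qed.

(** * Lines given by spanning pairs, and their incidence *)

Definition allz : seq trit := [:: None; I3; J3].
Definition allv : seq v4 :=
  [seq (p, q.1, q.2) | p <- [seq (a, b) | a <- allz, b <- allz],
                       q <- [seq (a, b) | a <- allz, b <- allz]].

Lemma mem_allz a : a \in allz. Proof. by case: a => [[]|]. Qed.

Lemma mem_allv w : w \in allv.
Proof.
case: w => [[p c] d].
have memp (p' : trit * trit) : p' \in [seq (a, b) | a <- allz, b <- allz].
  by case: p' => a b; apply/allpairsP; exists (a, b); rewrite !mem_allz.
by apply/allpairsP; exists (p, (c, d)); rewrite !memp.
Qed.

Definition comb (a b : trit) (l : ln) : v4 := add4 (scale4 a l.1) (scale4 b l.2).
Definition combs (l : ln) : seq v4 := [seq comb a b l | a <- allz, b <- allz].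
Definition onl (w : v4) (l : ln) : bool := w \in combs l.
Definition subl (l l' : ln) : bool := onl l.1 l' && onl l.2 l'.
Definition eql (l l' : ln) : bool := subl l l' && subl l' l.
Definition indep (l : ln) : bool :=
  all (fun a => all (fun b =>
    (comb a b l == zero4) ==> (a == None) && (b == None)) allz) allz.
Definition mact (m : m4) (l : ln) : ln := (mul4 l.1 m, mul4 l.2 m).

Definition dl (l : ln) : {set vec} := span2 (dv l.1) (dv l.2).

Lemma dv_comb a b l : dv (comb a b l) = dz a *: dv l.1 + dz b *: dv l.2.
Proof. by rewrite dvD !dvZ. Qed.

Lemma sub_span2P (K : fieldType) n (u v x : 'rV[K]_n) :
  reflect (exists a b, x = a *: u + b *: v) (x <= col_mx u v)%MS.
Proof.
apply: (iffP submxP) => [[C ->]|[a [b ->]]].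
  exists (lsubmx C 0 0), (rsubmx C 0 0).
  rewrite -[C in LHS]hsubmxK mul_row_col.
  by rewrite -!mul_scalar_mx -!mx11_scalar.
by exists (row_mx a%:M b%:M); rewrite mul_row_col !mul_scalar_mx.
Qed.

Lemma mem_span2 u v x : reflect (exists a b : F, x = a *: u + b *: v) (x \in span2 u v).
Proof. by rewrite inE; apply: sub_span2P. Qed.

Lemma mem_dl w l : (dv w \in dl l) = onl w l.
Proof.
apply/mem_span2/allpairsP => [[a [b def_w]]|[[a b] /= [_ _ ->]]].
  exists (ez a, ez b); rewrite !mem_allz; split=> //=.
  by apply: dv_inj; rewrite dv_comb !ezK.
by exists (dz a), (dz b); rewrite dv_comb.
Qed.

Lemma span2_sub u v u' v' :
  (span2 u v \subset span2 u' v') = (u \in span2 u' v') && (v \in span2 u' v').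
Proof.
apply/subsetP/andP => [sub | [u_in v_in] x].
  by split; apply: sub; apply/mem_span2; [exists 1, 0 | exists 0, 1];
    rewrite scale1r scale0r ?add0r ?addr0.
by move: u_in v_in; rewrite !inE => u_in v_in /submx_trans; apply; rewrite col_mx_sub u_in.
Qed.

Lemma dl_sub l l' : (dl l \subset dl l') = subl l l'.
Proof. by rewrite span2_sub !mem_dl. Qed.

Lemma eq_dl l l' : (dl l == dl l') = eql l l'.
Proof. by rewrite eqEsubset !dl_sub. Qed.

(** For a matrix with two rows, rank 2 means [row_free], hence a trivial left kernel; a kernel
    vector is a pair of coefficients, and there are only nine pairs to test. *)
Lemma rank_dl l : (\rank (col_mx (dv l.1) (dv l.2)) == 2)%N = indep l.
Proof.
rewrite [LHS](_ : _ = row_free (col_mx (dv l.1) (dv l.2))) // -kermx_eq0.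
apply/rowV0P/allP => [ker0 a _ | ind x /sub_kermxP].
  apply/allP => b _; apply/implyP => /eqP comb0.
  have := ker0 (row_mx (dz a)%:M (dz b)%:M).
  rewrite sub_kermx mul_row_col !mul_scalar_mx -dv_comb comb0 dv0 => /(_ (eqxx _)).
  rewrite -[0]row_mx0 => /eq_row_mx[/matrixP/(_ 0 0) + /matrixP/(_ 0 0)].
  by rewrite !mxE !mulr1n -[0]/(dz None) => /(can_inj dzK)-> /(can_inj dzK)->.
rewrite -[x]hsubmxK mul_row_col [lsubmx x]mx11_scalar [rsubmx x]mx11_scalar.
set a := lsubmx x 0 0; set b := rsubmx x 0 0.
rewrite !mul_scalar_mx -[a]ezK -[b]ezK -dv_comb -dv0 => /dv_inj comb0.
have /allP/(_ _ (mem_allz (ez b))) := ind _ (mem_allz (ez a)).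
by rewrite comb0 eqxx => /andP[/eqP-> /eqP->]; rewrite !raddf0 row_mx0.
Qed.

Lemma act_span2 (M : 'M[F]_4) u v : act M (span2 u v) = span2 (u *m M) (v *m M).
Proof.
apply/setP => x; apply/imsetP/mem_span2 => [[y /mem_span2[a [b ->]] ->]|[a [b ->]]].
  by exists a, b; rewrite mulmxDl !scalemxAl.
exists (a *: u + b *: v); last by rewrite mulmxDl !scalemxAl.
by apply/mem_span2; exists a, b.
Qed.

Lemma act_dl m l : act (dm m) (dl l) = dl (mact m l).
Proof. by rewrite act_span2 /dl !dv_mul. Qed.

(** * Reduced bases and the list of all lines *)

Definition pivot (w : v4) : nat := find (fun k => get w k != None) (iota 0 4).
(** Gauss-Jordan elimination on two rows. A nonzero scalar of F_3 is its own inverse, so multiplying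
    a row by its pivot entry turns that entry into 1. The zero vector has [pivot] 4 and is therefore
    sorted last. *)
Definition canon (l : ln) : ln :=
  let: (u, v) := if (pivot l.1 <= pivot l.2)%N then l else (l.2, l.1) in
  let i := pivot u in
  let u := scale4 (get u i) u in
  let v := add4 v (scale4 (opz (get v i)) u) in
  let j := pivot v in
  let v := scale4 (get v j) v in
  if v == zero4 then (u, v) else (add4 u (scale4 (opz (get u j)) v), v).

Definition reduced (l : ln) : bool := indep l && (canon l == l).
Definition allines : seq ln := [seq l <- [seq (u, v) | u <- allv, v <- allv] | reduced l].

Lemma mem_allines l : (l \in allines) = reduced l.
Proof.
rewrite mem_filter andb_idr // => _; case: l => u v.
by apply/allpairsP; exists (u, v); rewrite !mem_allv.
Qed.

(** Correctness of the elimination is verified on all 81^2 pairs of vectors instead of being derived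
    from the algorithm. *)
Lemma canon_check :
  all (fun u => all (fun v =>
    eql (canon (u, v)) (u, v) && (indep (u, v) ==> reduced (canon (u, v)))) allv) allv.
Proof. by vm_compute. Qed.

Lemma dl_canon l : dl (canon l) = dl l.
Proof.
case: l => u v; apply/eqP; rewrite eq_dl.
have /allP/(_ _ (mem_allv v))/andP[] // := allP canon_check _ (mem_allv u).
Qed.

Lemma reduced_canon l : indep l -> reduced (canon l).
Proof.
case: l => u v ind.
have /allP/(_ _ (mem_allv v))/andP[_] := allP canon_check _ (mem_allv u).
by rewrite ind.
Qed.

(** Uniqueness of the reduced echelon basis: it lets equality of lines be tested as equality of
    pairs. *)
Lemma allines_eql_check : all (fun l => all (fun l' => eql l l' ==> (l == l')) allines) allines.
Proof. by vm_compute. Qed.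

Lemma dl_inj_allines : {in allines &, injective dl}.
Proof.
move=> l l' Ml Ml' /eqP; rewrite eq_dl => eq_ll'.
by have /allP/(_ _ Ml')/implyP/(_ eq_ll')/eqP := allP allines_eql_check _ Ml.
Qed.

(** * Sets of lines as lists, and orbits under a listed set of matrices *)

Definition dls (s : seq ln) : {set {set vec}} := [set:: map dl s].

Lemma in_dls L s : (L \in dls s) = (L \in map dl s).
Proof. by rewrite inE. Qed.

(** In general a line may lie in [dls s] through a basis other than [l]; reducedness on both sides
    excludes this. *)
Lemma dl_in_dls l s : reduced l -> {subset s <= allines} -> (dl l \in dls s) = (l \in s).
Proof.
rewrite -mem_allines in_dls => Ml sM; apply/mapP/idP => [[l' sl' eq_ll']|]; last by exists l.
by rewrite (dl_inj_allines Ml (sM _ sl') eq_ll').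
Qed.

Lemma linesE : lines = dls allines.
Proof.
apply/setP => L; rewrite in_dls inE; apply/existsP/mapP => [[u /existsP[v]]|[l Ml ->]].
  rewrite -[u]evK -[v]evK => /andP[].
  rewrite (rank_dl (_, _)) => /reduced_canon; rewrite -mem_allines => ? /eqP->.
  by exists (canon (ev u, ev v)); rewrite // dl_canon.
exists (dv l.1); apply/existsP; exists (dv l.2); rewrite rank_dl eqxx andbT.
by move: Ml; rewrite mem_allines => /andP[].
Qed.

Lemma dlsU s t : dls s :|: dls t = dls (s ++ t).
Proof. by apply/setP => L; rewrite inE !in_dls map_cat mem_cat. Qed.

Lemma dls1 l : dls [:: l] = [set dl l].
Proof. by apply/setP => L; rewrite in_dls !inE. Qed.

Lemma eq_dls s t : s =i t -> dls s = dls t.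
Proof. by move=> eq_st; apply/setP => L; rewrite !in_dls; apply: eq_mem_map. Qed.

Definition diff (s t : seq ln) := [seq l <- s | l \notin t].

Lemma dlsD s t : {subset s <= allines} -> {subset t <= allines} -> dls s :\: dls t = dls (diff s t).
Proof.
move=> sM tM; apply/setP => L; apply/setDP/idP.
  rewrite in_dls => -[/mapP[l sl ->]]; have Ml := sM _ sl.
  rewrite !dl_in_dls -?mem_allines // => [? | ?]; rewrite mem_filter; last by case/andP=> _ /sM.
  by rewrite sl andbT.
rewrite in_dls => /mapP[l]; rewrite mem_filter => /andP[ntl sl] ->.
by rewrite !dl_in_dls -?mem_allines // ?sM.
Qed.

Lemma card_dls s : {subset s <= allines} -> uniq s -> #|dls s| = size s.
Proof.
move=> sM Us; rewrite cardsE -(size_map dl); apply/card_uniqP.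
by rewrite map_inj_in_uniq // => l l' /sM Ml /sM Ml'; apply: dl_inj_allines.
Qed.

Lemma dls_filter (p : pred {set vec}) (mp : pred ln) s :
  {in s, forall l, p (dl l) = mp l} -> [set L in dls s | p L] = dls (filter mp s).
Proof.
move=> p_mp; apply/setP => L; rewrite in_dls inE in_dls; apply/andP/mapP => [[/mapP[l sl ->]]|[l]].
  by rewrite p_mp // => ml; exists l; rewrite ?mem_filter ?ml.
by rewrite mem_filter => /andP[ml sl] ->; rewrite p_mp // ml map_f.
Qed.

(** Images are brought to reduced form before duplicates are removed, so that different bases of the
    same image line, such as those coming from [m] and its negative, are counted once. *)
Definition mimages (ms : seq m4) (l : ln) : seq ln := undup [seq canon (mact m l) | m <- ms].

Lemma act_orbit (G : {set 'M[F]_4}) (ms : seq m4) l :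
  G =i [seq dm m | m <- ms] -> [set act M (dl l) | M in G] = dls (mimages ms l).
Proof.
move=> Gms; apply/setP => L; rewrite in_dls; apply/imsetP/mapP => [[M]|[l']].
  rewrite Gms => /mapP[m ms_m ->] ->; rewrite act_dl -dl_canon.
  by exists (canon (mact m l)); rewrite // mem_undup; apply/mapP; exists m.
rewrite mem_undup => /mapP[m ms_m ->] ->.
by exists (dm m); rewrite ?Gms ?map_f // act_dl dl_canon.
Qed.

(** * Points, tangents and osculating planes of the cubic *)

Definition allt : seq (option trit) := [:: None; Some None; Some I3; Some J3].
(** Over F_3 one has 3 = 0, 2 = -1 and t^3 = t. This shortens the coordinates of points and tangent
    directions, and leaves x_0 - t x_3 as the equation of the osculating plane at a finite t. *)
Definition pt (t : option trit) : v4 :=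
  if t is Some t then (t, mulz t t, t, I3) else (I3, None, None, None).
Definition tdir (t : option trit) : v4 :=
  if t is Some t then (None, opz t, I3, None) else (None, I3, None, None).
Definition osceq (t : option trit) (w : v4) : trit :=
  if t is Some t then addz (get w 0) (opz (mulz t (get w 3))) else get w 3.
Definition dt (t : option trit) : option F := omap dz t.

Lemma three0 : 3%:R = 0 :> F. Proof. exact/val_inj. Qed.

Lemma expF3 (x : F) : x ^+ 3 = x.
Proof. by case: x => [[|[|[|//]]] lt_i3]; apply/val_inj. Qed.

Lemma Pt_dt t : Pt (dt t) = dv (pt t).
Proof. by case: t => [t|] //=; rewrite expF3 expr2 -dzM. Qed.

Lemma tandir_dt t : tandir (dt t) = dv (tdir t).
Proof.
case: t => [t|] //=; rewrite three0 mul0r /dv dzN; congr mkv.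
(* Adding 0 = 3t on the right turns 2t = -t into an identity valid in every commutative ring, within
   reach of [ring]. *)
by rewrite -[RHS]add0r -[0](mul0r (dz t)) -three0; ring.
Qed.

Lemma exists_dt (P : pred (option F)) : [exists t, P t] = has (fun t => P (dt t)) allt.
Proof.
apply/existsP/hasP => [[t Pt]|[t _ Pt]]; last by exists (dt t).
have dtK : dt (omap ez t) = t by case: t {Pt} => [t|] //=; rewrite ezK.
by exists (omap ez t); rewrite ?dtK //; case: (omap ez t) => [[[]|]|].
Qed.

Lemma dot_mkv a b c d w :
  (dv w *m (mkv a b c d)^T == 0) =
  (dz (get w 0) * a + dz (get w 1) * b + dz (get w 2) * c + dz (get w 3) * d == 0).
Proof.
case: w => [[[w0 w1] w2] w3].
have eq11 (A : 'M[F]_1) : (A == 0) = (A 0 0 == 0).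
  by apply/eqP/eqP => [->|A0]; rewrite ?mxE // [A]mx11_scalar A0 raddf0.
rewrite eq11; congr (_ == 0).
by rewrite mxE !big_ord_recl big_ord0 !mxE /= !addrA addr0.
Qed.

Lemma mem_osc t w : (dv w \in osc (dt t)) = (osceq t w == None).
Proof.
rewrite -(can_eq dzK); case: t => [t|]; rewrite inE dot_mkv; last first.
  by rewrite !mulr0 !add0r mulr1.
by rewrite /= three0 !mul0r oppr0 !mulr0 !addr0 mulr1 expF3 dzD dzN dzM mulrN mulrC.
Qed.

Lemma span2_sub_plane u v c : (span2 u v \subset plane c) = (u \in plane c) && (v \in plane c).
Proof.
apply/subsetP/andP => [sub | [u_in v_in] x].
  by split; apply: sub; apply/mem_span2; [exists 1, 0 | exists 0, 1];
    rewrite scale1r scale0r ?add0r ?addr0.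
move: u_in v_in; rewrite !inE => /eqP u0 /eqP v0 /sub_span2P[a [b ->]].
by rewrite mulmxDl -!scalemxAl u0 v0 !scaler0 addr0.
Qed.

Definition mGam l := has (fun t => (osceq t l.1 == None) && (osceq t l.2 == None)) allt.

Lemma in_GammaE l : in_Gamma (dl l) = mGam l.
Proof.
rewrite /in_Gamma (_ : [exists p in _, _] = [exists t, dl l \subset osc t]).
  rewrite exists_dt; apply: eq_has => t; rewrite -!mem_osc.
  by case: t => [t|]; rewrite span2_sub_plane.
apply/existsP/existsP => [[p /andP[/imsetP[t _ ->]]]|[t sub]]; first by exists t.
by exists (osc t); rewrite sub andbT; apply: imset_f.
Qed.

Definition mRC l := has (fun s => has (fun t => (s != t) && eql l (pt s, pt t)) allt) allt.
Definition mTr l := has (fun t => eql l (pt t, tdir t)) allt.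

Lemma dt_inj : injective dt.
Proof. by apply: inj_omap; apply: can_inj dzK. Qed.

Lemma RCE l : RC (dl l) = mRC l.
Proof.
rewrite /RC exists_dt; apply: eq_has => s; rewrite exists_dt; apply: eq_has => t.
by rewrite (inj_eq dt_inj) !Pt_dt -eq_dl.
Qed.

Lemma TrE l : Tr (dl l) = mTr l.
Proof.
by rewrite /Tr exists_dt; apply: eq_has => t; rewrite Pt_dt tandir_dt -eq_dl.
Qed.

Lemma mem_span1 u x : reflect (exists a : F, x = a *: u) (x \in span1 u).
Proof. by rewrite inE; apply: sub_rVP. Qed.

Lemma mem_span1_dv w w' : (dv w \in span1 (dv w')) = onl w (w', zero4).
Proof.
rewrite -mem_dl; apply/mem_span1/mem_span2 => [[a ->]|[a [b ->]]].
  by exists a, 0; rewrite dv0 scaler0 addr0.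
by exists a; rewrite dv0 scaler0 addr0.
Qed.

Lemma span1_sub u v : (span1 u \subset span1 v) = (u \in span1 v).
Proof.
apply/subsetP/idP => [|u_v x]; first by apply; rewrite inE.
by move: u_v; rewrite !inE => ? /submx_trans; apply.
Qed.

Lemma span1_sub2 u v w : (span1 u \subset span2 v w) = (u \in span2 v w).
Proof.
apply/subsetP/idP => [|u_v x]; first by apply; rewrite inE.
by move: u_v; rewrite !inE => ? /submx_trans; apply.
Qed.

(** The only nonzero scalars are 1 and -1, so these are all the coordinate vectors of a point of the
    cubic. *)
Definition opts (t : option trit) : seq v4 := [:: pt t; scale4 J3 (pt t)].

Lemma span1_pt_check : all (fun t => all (fun w =>
  (onl w (pt t, zero4) && onl (pt t) (w, zero4)) == (w \in opts t)) allv) allt.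
Proof. by vm_compute. Qed.

Lemma mem_allt t : t \in allt. Proof. by case: t => [[[]|]|]. Qed.

Lemma eq_span1_pt w t : (span1 (dv w) == span1 (dv (pt t))) = (w \in opts t).
Proof.
rewrite eqEsubset !span1_sub !mem_span1_dv.
by have /allP/(_ _ (mem_allv w))/eqP := allP span1_pt_check _ (mem_allt t).
Qed.

Lemma in_Cpts P : (P \in Cpts) = has (fun t => P == span1 (dv (pt t))) allt.
Proof.
rewrite (eq_has (_ : _ =1 (fun t => P == span1 (Pt (dt t))))); last by move=> t; rewrite Pt_dt.
rewrite -(exists_dt (fun t => P == span1 (Pt t))).
by apply/imsetP/existsP => [[t _ ->]|[t /eqP->]]; exists t.
Qed.

Definition mnpts l := count (fun t => onl (pt t) l) allt.

(** Distinct parameters give distinct points, so points of the cubic on a line may be counted by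
    their parameters. *)
Lemma nptsE l : npts (dl l) = mnpts l.
Proof.
pose s := [seq span1 (dv (pt t)) | t <- [seq t <- allt | onl (pt t) l]].
rewrite /npts (eq_card (_ : _ =i s)) => [|P].
  rewrite (card_uniqP _) ?size_map ?size_filter // map_inj_in_uniq ?filter_uniq //.
  by move=> t t' _ _ /eqP; rewrite eq_span1_pt; move: t t' => [[[]|]|] [[[]|]|].
rewrite inE in_Cpts; apply/andP/mapP => [[/hasP[t _ /eqP->]]|[t]].
  by rewrite span1_sub2 mem_dl => ont; exists t; rewrite // mem_filter ont mem_allt.
rewrite mem_filter => /andP[ont _] ->; split; last by rewrite span1_sub2 mem_dl.
by apply/hasP; exists t; rewrite ?mem_allt.
Qed.

(** * The Ar-line *)

Definition lA : ln := ((None, I3, None, None), (None, None, I3, None)).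
Definition mmeet l := has (fun w => onl w lA && (w != zero4)) (combs l).

(* A subspace cut out by linear equations is compared with a spanned one by
   testing all 81 vectors. *)
Lemma set_dl (S : {set vec}) (p : pred v4) l :
  (forall w, (dv w \in S) = p w) -> all (fun w => p w == onl w l) allv -> S = dl l.
Proof.
move=> Sp /allP eqp; apply/setP => x; rewrite -[x]evK mem_dl Sp.
by apply/eqP/eqp; rewrite mem_allv.
Qed.

Lemma AlineE : Aline = dl lA.
Proof.
apply: (@set_dl _ (fun w => (get w 0 == None) && (get w 3 == None))); last by vm_compute.
by move=> w; rewrite inE !crd_dv // -!(can_eq dzK).
Qed.

Lemma meets_AlineE l : meets (dl l) Aline = mmeet l.
Proof.
rewrite AlineE; apply/existsP/hasP => [[x]|[w wl /andP[wA w0]]].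
  rewrite -{1}[x]evK inE !mem_dl => /andP[/andP[wl wA]] x0.
  exists (ev x) => //; rewrite wA /=.
  by apply: contraNneq x0 => ev0; rewrite -[x]evK ev0 dv0.
exists (dv w); rewrite inE !mem_dl wA andbT /onl wl -dv0 /=.
by apply: contraNneq w0 => /dv_inj->.
Qed.

(** * The critical subgroup *)

Definition mkm (w : v4) : m4 :=
  let: (a, b, c, d) := w in let p := mulz in let s := addz in
  ((p a (p a a), p a (p a c), p a (p c c), p c (p c c)),
   (None, s (p a (p a d)) (p J3 (p a (p b c))),
          s (p b (p c c)) (p J3 (p a (p c d))), None),
   (None, s (p b (p b c)) (p J3 (p a (p b d))),
          s (p a (p d d)) (p J3 (p b (p c d))), None),
   (p b (p b b), p b (p b d), p b (p d d), p d (p d d))).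
Definition mdet (w : v4) : trit :=
  addz (mulz (get w 0) (get w 3)) (opz (mulz (get w 1) (get w 2))).
Definition mGs : seq m4 := [seq mkm w | w <- allv & mdet w != None].

Lemma two_dz : 2%:R = dz J3. Proof. exact/val_inj. Qed.

(** The entries agree once the multiples of 3 vanish and 2 is read as -1. *)
Lemma Mabcd_dz a b c d : Mabcd (dz a) (dz b) (dz c) (dz d) = dm (mkm (a, b, c, d)).
Proof.
apply/matrixP => i j; rewrite !mxE.
case: i => [[|[|[|[|//]]]] lt_i4]; rewrite !mxE; case: j => [[|[|[|[|//]]]] lt_j4] /=.
all: rewrite ?three0 ?two_dz ?dzD ?dzM ?[dz None]/=; ring.
Qed.

Lemma GstarE : Gstar =i [seq dm m | m <- mGs].
Proof.
move=> M; apply/imsetP/mapP => [[[[[a b] c] d]]|[m /mapP[w + ->] ->]].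
  rewrite inE /= -[a]ezK -[b]ezK -[c]ezK -[d]ezK Mabcd_dz => det_n0 ->.
  exists (mkm (ez a, ez b, ez c, ez d)) => //; apply/map_f.
  rewrite mem_filter mem_allv andbT; apply: contraNneq det_n0 => /= det0.
  by rewrite -!dzM -dzN -dzD; rewrite /mdet /= in det0; rewrite det0.
case: w => [[[a b] c] d]; rewrite mem_filter => /andP[det_n0 _].
exists (dz a, dz b, dz c, dz d); last by rewrite Mabcd_dz.
by rewrite inE /= -!dzM -dzN -dzD -[0]/(dz None) (can_eq dzK).
Qed.

(** * The full group G_3 *)

Definition basis4 : m4 := (pt None, pt (Some None), pt (Some I3), pt (Some J3)).
Definition binv : m4 :=
  ((I3, None, None, None), (None, J3, J3, J3), (J3, None, J3, I3), (None, I3, None, None)).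
(** The two conjuncts are the two inclusions between the image of the cubic and the cubic. *)
Definition permC (m : m4) : bool :=
  all (fun t => has (fun t' => mul4 (pt t) m \in opts t') allt) allt &&
  all (fun t' => has (fun t => mul4 (pt t) m \in opts t') allt) allt.
Definition spts : seq v4 := flatten [seq opts t | t <- allt].
(** The rows of [basis4] are the four points of the cubic and [binv] is its inverse, so a matrix is
    [binv] times the matrix of the images of these rows. Each image has 8 candidates in [spts],
    which leaves 8^4 matrices to filter instead of 3^16. *)
Definition mG3 : seq m4 :=
  let sq := [seq (p, q) | p <- spts, q <- spts] in
  [seq m <- [seq mulm binv (pq, r.1, r.2) | pq <- sq, r <- sq] | permC m].

Lemma act_span1 (M : 'M[F]_4) u : act M (span1 u) = span1 (u *m M).
Proof.
apply/setP => x; apply/imsetP/mem_span1 => [[y /mem_span1[a ->] ->]|[a ->]].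
  by exists a; rewrite scalemxAl.
by exists (a *: u); [apply/mem_span1; exists a | rewrite scalemxAl].
Qed.

Lemma Cpts_permC m : ([set act (dm m) P | P in Cpts] == Cpts) = permC m.
Proof.
have actE t : act (dm m) (span1 (dv (pt t))) = span1 (dv (mul4 (pt t) m)).
  by rewrite act_span1 dv_mul.
have Cpt t : span1 (dv (pt t)) \in Cpts.
  by rewrite in_Cpts; apply/hasP; exists t; rewrite ?mem_allt.
rewrite eqEsubset; congr (_ && _).
  apply/subsetP/allP => [sub t _|ok P /imsetP[P0]].
    have:= sub _ (imset_f _ (Cpt t)); rewrite actE in_Cpts.
    by rewrite (eq_has (eq_span1_pt _)).
  rewrite in_Cpts => /hasP[t t_in /eqP->] ->; rewrite actE in_Cpts.
  by rewrite (eq_has (eq_span1_pt _)) ok.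
apply/subsetP/allP => [sub t' _|ok P].
  have /imsetP[P] := sub _ (Cpt t'); rewrite in_Cpts => /hasP[t t_in /eqP->].
  by move/esym/eqP; rewrite actE eq_span1_pt => ?; apply/hasP; exists t.
rewrite in_Cpts => /hasP[t' t'_in /eqP->]; have /hasP[t t_in] := ok _ t'_in.
by rewrite -eq_span1_pt -actE => /eqP <-; apply: imset_f.
Qed.

Lemma binv_basis4 : mulm binv basis4 = id4. Proof. by vm_compute. Qed.

Definition sqm (m : m4) : m4 := mulm m m.

(* The monomial group has exponent 24, which makes invertibility a computation. *)
Lemma exp24_check : all (fun m => sqm (sqm (sqm (mulm m (sqm m)))) == id4) mG3.
Proof. by vm_compute. Qed.

Lemma dm_inj : injective dm.
Proof.
move=> m m' eq_mm'; suff eqr k : (k < 4)%N -> row4 m k = row4 m' k.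
  move: m m' eqr {eq_mm'} => [[[a b] c] d] [[[a' b'] c'] d'] eqr.
  by rewrite [a](eqr 0%N) // [b](eqr 1%N) // [c](eqr 2%N) // [d](eqr 3%N).
move=> lt_k4; apply: dv_inj; move/(congr1 (row (Ordinal lt_k4))): eq_mm'.
by rewrite !rowK.
Qed.

Lemma mG3_unit m : m \in mG3 -> dm m \in unitmx.
Proof.
move/(allP exp24_check)/eqP/(congr1 dm); rewrite /sqm !dm_mul dm1.
by case/mulmx1_unit => + _; rewrite !unitmx_mul !andbb.
Qed.

Lemma mem_spts t w : w \in opts t -> w \in spts.
Proof. by move=> tw; apply/flattenP; exists (opts t); rewrite // map_f ?mem_allt. Qed.

Lemma permC_mG3 m : permC m -> m \in mG3.
Proof.
move=> Pm; rewrite mem_filter Pm andTb.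
have img t : mul4 (pt t) m \in spts.
  have /andP[/allP/(_ t (mem_allt t))/hasP[t' _ tm] _] := Pm.
  exact: mem_spts tm.
apply/allpairsP; exists ((mul4 (pt None) m, mul4 (pt (Some None)) m),
  (mul4 (pt (Some I3)) m, mul4 (pt (Some J3)) m)).
split; rewrite ?allpairs_f ?img //.
(* The four chosen images are the rows of [mulm basis4 m], and multiplying by [binv] recovers
   [m]. *)
apply: dm_inj; rewrite -[RHS]/(dm (mulm binv (mulm basis4 m))).
by rewrite !dm_mul mulmxA -dm_mul binv_basis4 dm1 mul1mx.
Qed.

Lemma G3E : G3 =i [seq dm m | m <- mG3].
Proof.
move=> M; rewrite inE; apply/andP/mapP => [[_]|[m m_in ->]].
  by rewrite -{1}[M]emK Cpts_permC => Pm; exists (em M); rewrite ?permC_mG3 ?emK.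
by rewrite mG3_unit // Cpts_permC; move: m_in; rewrite mem_filter => /andP[].
Qed.

(** * The field with nine elements and the imaginary chords *)

Lemma pchar_F9 : 3 \in [pchar F9].
Proof. exact: (s2valP (pPrimePowerField prime3 lt0_2)). Qed.

Lemma card_F9 : #|F9| = 9.
Proof. exact: (s2valP' (pPrimePowerField prime3 lt0_2)). Qed.

Lemma three9 : 3%:R = 0 :> F9. Proof. exact: pcharf0 pchar_F9. Qed.

Lemma to9_dz a : to9 (dz a) = if a is Some b then if b then 1 else -1 else 0.
Proof.
case: a => [[]|] //; rewrite /to9 /=.
by apply/eqP; rewrite -subr_eq0 opprK -natr1 -addrA -[1 + 1]/(2%:R) -natrD three9.
Qed.

(** [to9] goes through natural representatives, so additivity has to absorb a multiple of 3; it is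
    checked on the nine pairs of values. *)
Lemma to9_is_zmod_morphism : zmod_morphism to9.
Proof.
move=> x y; rewrite -[x]ezK -[y]ezK -dzN -dzD !to9_dz; have := three9.
case: (ez x) (ez y) => [[]|] [[]|] /= three0; rewrite ?subrr ?subr0 ?sub0r ?opprK //.
  by apply/esym/eqP; rewrite -subr_eq0 -three0; apply/eqP; ring.
by apply/eqP; rewrite -subr_eq0 -three0; apply/eqP; ring.
Qed.

Lemma to9_is_monoid_morphism : monoid_morphism to9.
Proof.
split=> [|x y]; first exact: (to9_dz I3).
rewrite -[x]ezK -[y]ezK -dzM !to9_dz.
by case: (ez x) (ez y) => [[]|] [[]|] /=; ring.
Qed.

HB.instance Definition _ := GRing.isZmodMorphism.Build F F9 to9 to9_is_zmod_morphism.
HB.instance Definition _ := GRing.isMonoidMorphism.Build F F9 to9 to9_is_monoid_morphism.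

(** The coefficients of a and of 1 in a^3, a^2, a, 1 when a^2 = s a + n; in particular a^3 = (s^2 +
    n) a + s n. *)
Definition icl (s n : trit) : ln :=
  ((addz (mulz s s) n, s, I3, None), (mulz s n, n, None, I3)).

Lemma map_dv w : map_mx to9 (dv w) =
  \row_(j < 4) [:: to9 (dz (get w 0)); to9 (dz (get w 1));
                   to9 (dz (get w 2)); to9 (dz (get w 3))]`_j.
Proof.
case: w => [[[a b] c] d]; apply/rowP => j; rewrite !mxE.
by case: j => [[|[|[|[|//]]]] lt_j4].
Qed.

(* If [a] is a root of X^2 - s X - n, then (a^3, a^2, a, 1) = a u + v
   for the basis (u, v) of [icl s n]. *)
Lemma Pt9_icl s n (a : F9) : a ^+ 2 = to9 (dz s) * a + to9 (dz n) ->
  Pt9 a = a *: map_mx to9 (dv (icl s n).1) + map_mx to9 (dv (icl s n).2).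
Proof.
move=> a2; apply/rowP => j; rewrite !map_dv !mxE.
have a3 : a ^+ 3 = a * (to9 (dz s) * to9 (dz s) + to9 (dz n)) + to9 (dz s) * to9 (dz n).
  by rewrite exprS a2; ring: a2.
case: j => [[|[|[|[|//]]]] lt_j4] /=; rewrite ?rmorph0 ?rmorph1 ?dzD ?dzM ?rmorphD ?rmorphM //=.
- by rewrite a2; ring.
- by rewrite mulr1 addr0.
- by rewrite mulr0 add0r.
Qed.

(** Cubing is the Frobenius automorphism, which fixes coefficients in F_3 and so permutes the roots
    of the quadratic. *)
Lemma Frob_root s n (a : F9) : a ^+ 2 = to9 (dz s) * a + to9 (dz n) ->
  (a ^+ 3) ^+ 2 = to9 (dz s) * a ^+ 3 + to9 (dz n).
Proof.
move/(congr1 (pFrobenius_aut pchar_F9)).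
by rewrite rmorphD rmorphXn rmorphM /= !pFrobenius_autE -!rmorphXn !expF3.
Qed.

Lemma Pt9_span s n (a : F9) : a ^+ 2 = to9 (dz s) * a + to9 (dz n) -> a ^+ 3 != a ->
  (col_mx (Pt9 a) (Pt9 (a ^+ 3)) ==
   col_mx (map_mx to9 (dv (icl s n).1)) (map_mx to9 (dv (icl s n).2)))%MS.
Proof.
move=> a2 a3_neq; have b2 := Frob_root a2.
rewrite (Pt9_icl a2) (Pt9_icl b2); set b := a ^+ 3 in b2 a3_neq *.
set u := map_mx _ _; set v := map_mx _ _; have ba_n0 : b - a != 0 by rewrite subr_eq0.
apply/andP; split; rewrite col_mx_sub; apply/andP; split; apply/sub_span2P.
- by exists a, 1; rewrite scale1r.
- by exists b, 1; rewrite scale1r.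
(* Since P(a) = a u + v and P(b) = b u + v, subtraction gives u = (P(b) - P(a)) / (b - a). *)
- exists (- (b - a)^-1), (b - a)^-1; rewrite !scalerDr !scalerA addrACA -!scalerDl.
  rewrite mulNr addNr scale0r addr0 addrC -mulrBr mulVf ?scale1r //.
(* Eliminating u instead gives v = (b P(a) - a P(b)) / (b - a). *)
exists (b / (b - a)), (- (a / (b - a))); rewrite !scalerDr !scalerA addrACA -!scalerDl.
rewrite -mulrBl mulfV // scale1r mulNr mulrAC [b * a]mulrC [a / _ * b]mulrAC.
by rewrite subrr scale0r add0r.
Qed.

(** A pair (s, n) stands for X^2 - s X - n; these are the three monic irreducible quadratics over
    F_3. *)
Definition quadratics : seq (trit * trit) := [:: (None, J3); (I3, I3); (J3, I3)].

Lemma F9_quadratic (a : F9) : a ^+ 3 != a ->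
  exists2 q, q \in quadratics & a ^+ 2 = to9 (dz q.1) * a + to9 (dz q.2).
Proof.
move=> a3_neq; have a9 : a ^+ 9 = a by rewrite -{2}(expf_card a) card_F9.
have : (a ^+ 3 - a) * (a ^+ 2 + 1) * (a ^+ 2 - a - 1) * (a ^+ 2 + a - 1) = 0.
  (* Modulo 3 the product is X^9 - X, the polynomial vanishing on F_9; the last term is the exact
     error over the integers. *)
  transitivity (a ^+ 9 - a - 3%:R * (a ^+ 7 - a ^+ 3)); first by ring.
  by rewrite a9 three9 mul0r !subrr.
move/eqP; rewrite !mulf_eq0 subr_eq0 (negPf a3_neq) /=.
case/orP=> [/orP[]|] /eqP a2.
- by exists (None, J3); rewrite // !to9_dz; apply/subr0_eq; rewrite -[RHS]a2 /=; ring.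
- by exists (I3, I3); rewrite // !to9_dz; apply/subr0_eq; rewrite -[RHS]a2 /=; ring.
- by exists (J3, I3); rewrite // !to9_dz; apply/subr0_eq; rewrite -[RHS]a2 /=; ring.
Qed.

(** Some element lies outside F_3, hence is a root of one of the three quadratics; completing the
    square gives a square root of -1. *)
Lemma F9_sqrtN1 : exists i : F9, i ^+ 2 = -1.
Proof.
have /existsP[a /F9_quadratic[q]] : [exists a : F9, a ^+ 3 != a].
  (* If cubing fixed every element, X^3 - X would have nine roots. *)
  rewrite -negb_forall; apply/negP => /forallP a3.
  have: (#|F9| < size (('X^3 - 'X)%R : {poly F9}))%N.
    rewrite cardE; apply: max_poly_roots; last exact: enum_uniq.
      by rewrite -size_poly_eq0 size_polyDl size_polyXn // size_polyN size_polyX.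
    by apply/allP => a _; rewrite rootE !hornerE subr_eq0.
  by rewrite card_F9 size_polyDl size_polyXn // size_polyN size_polyX.
rewrite !inE => /or3P[] /eqP->; rewrite !to9_dz /= => a2.
- by exists a; rewrite a2; ring.
- by exists (a + 1); rewrite -[RHS](addr0) -(mul0r (a + 1)) -three9; ring: a2.
- by exists (a - 1); rewrite -[RHS](addr0) -(mul0r (- a + 1)) -three9; ring: a2.
Qed.

(** All three pairs satisfy n = -s^2 - 1, so in characteristic 3 the quadratic is (X + s)^2 + 1,
    with root i - s. *)
Lemma F9_root q : q \in quadratics ->
  exists2 a : F9, a ^+ 3 != a & a ^+ 2 = to9 (dz q.1) * a + to9 (dz q.2).
Proof.
have [i i2] := F9_sqrtN1.
have i_n0 : i != 0.
  by apply: contra_eq_neq i2 => ->; rewrite expr0n eq_sym oppr_eq0 oner_eq0.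
have root s n : to9 s ^+ 3 = to9 s -> - to9 s ^+ 2 - 1 = to9 n ->
    (i - to9 s) ^+ 3 != i - to9 s /\ (i - to9 s) ^+ 2 = to9 s * (i - to9 s) + to9 n.
  move=> s3 <-; set t := to9 s in s3 *; split; last first.
    by rewrite -[RHS]addr0 -(mul0r (t ^+ 2 - t * i)) -three9; ring: i2.
  (* The cube of i - t is -i - t, and subtracting i - t leaves -2i = i, which is nonzero. *)
  rewrite -subr_eq0 (_ : _ - _ = i) //.
  rewrite -[RHS]addr0 -(mul0r (- i + t + i * t ^+ 2)) -three9; ring: i2 s3.
case: q => s n q_in /=.
have def_n : - dz s ^+ 2 - 1 = dz n.
  by move: q_in; rewrite !inE => /or3P[] /eqP[-> ->]; apply/val_inj.
have [] := root (dz s) (dz n); last by exists (i - to9 (dz s)).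
  by rewrite -rmorphXn expF3.
by rewrite -def_n rmorphB rmorphN rmorphXn rmorph1.
Qed.

Lemma span2_eqmx u v u' v' : (col_mx u v == col_mx u' v')%MS -> span2 u v = span2 u' v'.
Proof.
case/andP=> le ge; apply/setP => x; rewrite !inE.
by apply/idP/idP => /submx_trans; apply.
Qed.

Definition mIC l := has (fun q => eql l (icl q.1 q.2)) quadratics.

Lemma indep_icl s n : indep (icl s n).
Proof. by case: s n => [[]|] [[]|]. Qed.

(** The chord through a and its conjugate depends only on their minimal polynomial, so there is one
    chord for each of the three quadratics. *)
Lemma ICE l : reduced l -> IC (dl l) = mIC l.
Proof.
case/andP=> ind _; apply/existsP/hasP => [[u /existsP[v /existsP[a]]]|[[s n] q_in]].
  case/and4P=> _ /eqP def_l a3_neq eq_uv.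
  have [[s n] q_in a2] := F9_quadratic a3_neq; exists (s, n) => //.
  have /andP[le1 ge1] := Pt9_span a2 a3_neq; have /andP[le2 ge2] := eq_uv.
  rewrite -eq_dl def_l; apply/eqP/span2_eqmx.
  (* Inclusion of row spaces over F_3 may be tested after extending scalars to F_9. *)
  rewrite -!(map_submx to9) !map_col_mx.
  by rewrite (submx_trans le2 le1) (submx_trans ge1 ge2).
rewrite -eq_dl => /eqP->; have [a a3_neq a2] := F9_root q_in.
exists (dv (icl s n).1); apply/existsP; exists (dv (icl s n).2).
apply/existsP; exists a; rewrite rank_dl indep_icl eqxx a3_neq /=.
by have := Pt9_span a2 a3_neq; rewrite andbC.
Qed.

(** * The types and sub-types of lines as lists *)

Definition mUG l := [&& mnpts l == 1, ~~ mTr l & mGam l].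
Definition mEA l := [&& mnpts l == 0, ~~ eql l lA & mmeet l].
Definition mEnG l := [&& mnpts l == 0, ~~ mmeet l & ~~ mIC l].

Definition lUn1 : ln := ((I3, None, None, None), (None, I3, J3, J3)).
Definition lUn2 : ln := ((I3, None, None, None), (None, I3, None, J3)).
Definition lEA2 : ln := ((None, I3, None, J3), (None, None, I3, None)).
Definition lEA3 : ln := ((I3, None, I3, None), (None, I3, None, None)).
Definition lEn3 : ln := ((I3, None, I3, None), (None, I3, None, J3)).

Definition sorb (l : ln) : seq ln := mimages mGs l.
Definition lselect (p : pred ln) : seq ln := [seq l <- allines | p l].
Definition sEA1 : seq ln := diff (lselect mEA) (sorb lEA2 ++ sorb lEA3).
Definition sEnR : seq ln := diff (lselect mEnG) (sorb lEn3).
Definition sEn (n : nat) : seq ln := [seq l <- sEnR | size (sorb l) == n].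

Lemma lines_lselect (p : pred {set vec}) (mp : pred ln) :
  (forall l, reduced l -> p (dl l) = mp l) -> [set L in lines | p L] = dls (lselect mp).
Proof. by move=> p_mp; rewrite linesE; apply: dls_filter => l; rewrite mem_allines => /p_mp. Qed.

Lemma SorbE l : Sorb (dl l) = dls (sorb l).
Proof. exact: act_orbit GstarE. Qed.

Lemma MorbE l : Morb (dl l) = dls (mimages mG3 l).
Proof. exact: act_orbit G3E. Qed.

Lemma RC_linesE : RC_lines = dls (lselect mRC).
Proof. by apply: lines_lselect => l _; apply: RCE. Qed.

Lemma Tr_linesE : Tr_lines = dls (lselect mTr).
Proof. by apply: lines_lselect => l _; apply: TrE. Qed.

Lemma IC_linesE : IC_lines = dls (lselect mIC).
Proof. exact: lines_lselect ICE. Qed.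

Lemma UG_linesE : UG_lines = dls (lselect mUG).
Proof. by apply: lines_lselect => l _; rewrite /UG /unisecant nptsE TrE in_GammaE. Qed.

Lemma EA_linesE : EA_lines = dls (lselect mEA).
Proof.
by apply: lines_lselect => l _; rewrite /EA /external nptsE meets_AlineE AlineE eq_dl.
Qed.

Lemma EnG_linesE : EnG_lines = dls (lselect mEnG).
Proof.
by apply: lines_lselect => l /ICE ICl; rewrite /EnG /external nptsE meets_AlineE ICl.
Qed.

Lemma UnG1E : UnG1 = dls (sorb lUn1).
Proof.
rewrite -SorbE; congr Sorb; apply: (@set_dl _ (fun w =>
  (get w 1 == opz (get w 2)) && (get w 1 == opz (get w 3)))); last by vm_compute.
by move=> w; rewrite inE !crd_dv // -!dzN !(can_eq dzK).
Qed.

Lemma UnG2E : UnG2 = dls (sorb lUn2).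
Proof.
rewrite -SorbE; congr Sorb; apply: (@set_dl _ (fun w =>
  (get w 2 == None) && (get w 1 == opz (get w 3)))); last by vm_compute.
by move=> w; rewrite inE !crd_dv // -[0]/(dz None) -!dzN !(can_eq dzK).
Qed.

Lemma EA2E : EA2 = dls (sorb lEA2).
Proof.
rewrite -SorbE; congr Sorb; apply: (@set_dl _ (fun w =>
  (get w 0 == None) && (get w 1 == opz (get w 3)))); last by vm_compute.
by move=> w; rewrite inE !crd_dv // -[0]/(dz None) -!dzN !(can_eq dzK).
Qed.

Lemma EA3E : EA3 = dls (sorb lEA3).
Proof.
rewrite -SorbE; congr Sorb; apply: (@set_dl _ (fun w =>
  (get w 0 == get w 2) && (get w 3 == None))); last by vm_compute.
by move=> w; rewrite inE !crd_dv // -[0]/(dz None) !(can_eq dzK).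
Qed.

Lemma EnG3E : EnG3 = dls (sorb lEn3).
Proof.
rewrite -SorbE; congr Sorb; apply: (@set_dl _ (fun w =>
  (get w 0 == get w 2) && (get w 1 == opz (get w 3)))); last by vm_compute.
by move=> w; rewrite inE !crd_dv // -!dzN !(can_eq dzK).
Qed.

Lemma lselect_sub p : {subset lselect p <= allines}.
Proof. by move=> l; rewrite mem_filter => /andP[]. Qed.

Lemma sub_allines s : all reduced s -> {subset s <= allines}.
Proof. by move/allP=> sM l /sM; rewrite mem_allines. Qed.

Lemma EA1E : EA1 = dls sEA1.
Proof.
rewrite /EA1 EA_linesE EA2E EA3E dlsU dlsD; [by []| exact: lselect_sub |].
by apply: sub_allines; vm_compute.
Qed.

Lemma EnG_rest : EnG_lines :\: EnG3 = dls sEnR.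
Proof.
rewrite EnG_linesE EnG3E dlsD; [by []| exact: lselect_sub |].
by apply: sub_allines; vm_compute.
Qed.

(** With all images reduced, the length of [sorb l] is the size of the orbit, as the selection by
    orbit size in [sEn] requires. *)
Lemma card_Sorb_check : all (fun l => all reduced (sorb l)) sEnR.
Proof. by vm_compute. Qed.

Lemma sEnE n : [set L in EnG_lines :\: EnG3 | #|Sorb L| == n] = dls (sEn n).
Proof.
rewrite EnG_rest; apply: dls_filter => l /(allP card_Sorb_check)/sub_allines lM.
by rewrite SorbE card_dls // undup_uniq.
Qed.

(** * The seven classes and the computations on them *)

Definition classes : seq (seq ln) :=
  [:: lselect mRC; sEn 12; lselect mTr ++ sorb lUn2; (lselect mIC ++ [:: lA]) ++ sorb lEA2;
      lselect mUG ++ sorb lUn1; sEA1 ++ sEn 24; sorb lEA3 ++ sorb lEn3].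

Lemma classes_sizes : [seq size s | s <- classes] = [:: 6; 12; 16; 8; 24; 48; 16].
Proof. by vm_compute. Qed.

Lemma classes_reduced : all (all reduced) classes. Proof. by vm_compute. Qed.

Lemma classes_uniq : all uniq classes. Proof. by vm_compute. Qed.

(** The orbit is computed for the head of each class only; the group structure of G_3 extends the
    result to the other members. *)
Lemma classes_orbit : all (fun s => perm_eq (mimages mG3 (head lA s)) s) classes.
Proof. by vm_compute. Qed.

Lemma classes_cover : all (fun l => l \in flatten classes) allines. Proof. by vm_compute. Qed.

Lemma classes_head : all (fun s => head lA s \in s) classes. Proof. by vm_compute. Qed.

Lemma classes_disjoint :
  all (fun s => all (fun s' => (head lA s \in s') ==> (s == s')) classes) classes.
Proof. by vm_compute. Qed.

Lemma uniq_classes : uniq classes. Proof. by vm_compute. Qed.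

(** Recorded as an equation so that [classes] can still be expanded by rewriting once it is opaque;
    opacity keeps conversion from evaluating the enumerations. *)
Lemma classesE : classes =
  [:: lselect mRC; sEn 12; lselect mTr ++ sorb lUn2; (lselect mIC ++ [:: lA]) ++ sorb lEA2;
      lselect mUG ++ sorb lUn1; sEA1 ++ sEn 24; sorb lEA3 ++ sorb lEn3].
Proof. by []. Qed.

Opaque allines mG3 mGs classes lselect sorb sEn sEA1 sEnR diff mimages dls.

(** * Orbits under G_3 as a group, and the conclusion *)

Lemma actM (M N : 'M[F]_4) S : act (M *m N) S = act N (act M S).
Proof. by rewrite /act -imset_comp; apply: eq_imset => x /=; rewrite mulmxA. Qed.

Lemma act1 S : act 1%:M S = S.
Proof. by rewrite -[RHS]imset_id; apply: eq_imset => x; rewrite mulmx1. Qed.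

Lemma imset_actM (M N : 'M[F]_4) (A : {set {set vec}}) :
  [set act (M *m N) P | P in A] = [set act N P | P in [set act M P | P in A]].
Proof. by rewrite -imset_comp; apply: eq_imset => P /=; rewrite actM. Qed.

Lemma G3M M N : M \in G3 -> N \in G3 -> M *m N \in G3.
Proof.
rewrite !inE unitmx_mul => /andP[-> /eqP CM] /andP[-> /eqP CN].
by rewrite imset_actM CM CN eqxx.
Qed.

Lemma G3V M : M \in G3 -> invmx M \in G3.
Proof.
rewrite !inE unitmx_inv => /andP[uM /eqP CM]; rewrite uM /=.
rewrite -{1}CM -imset_actM mulmxV //; apply/eqP; rewrite -[RHS]imset_id.
by apply: eq_imset => P; rewrite act1.
Qed.

(** Translation by [M] permutes G_3, with [invmx M] giving the way back. *)
Lemma Morb_act M L : M \in G3 -> Morb (act M L) = Morb L.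
Proof.
move=> GM; apply/setP => L'; apply/imsetP/imsetP => [][N GN ->].
  by exists (M *m N); rewrite ?G3M // actM.
exists (invmx M *m N); first by rewrite G3M ?G3V.
have /andP[uM _] : (M \in unitmx) && ([set act M P | P in Cpts] == Cpts) by rewrite inE in GM.
by rewrite -actM mulmxA mulmxV // mul1mx.
Qed.

(** A member of the class is an image of the head, so both have the same orbit. *)
Lemma Morb_class s l : s \in classes -> l \in s -> Morb (dl l) = dls s.
Proof.
move=> s_in sl; have orb_h : Morb (dl (head lA s)) = dls s.
  by rewrite MorbE; apply/eq_dls/perm_mem/(allP classes_orbit).
have : dl l \in Morb (dl (head lA s)) by rewrite orb_h in_dls map_f.
by case/imsetP=> M GM ->; rewrite Morb_act.
Qed.

(** Every line lies in some class, which is then its orbit; conversely each class is the orbit of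
    its head. *)
Lemma line_orbitsE : line_orbits = [set:: map dls classes].
Proof.
apply/setP => X; rewrite inE; apply/imsetP/mapP => [[L]|[s s_in ->]].
  rewrite linesE in_dls => /mapP[l /(allP classes_cover)/flattenP[s s_in sl] ->] ->.
  by exists s; [exact: s_in | exact: Morb_class].
have s_h := allP classes_head _ s_in.
exists (dl (head lA s)); last by rewrite (Morb_class s_in s_h).
by rewrite linesE in_dls; apply/map_f/(sub_allines (allP classes_reduced _ s_in)).
Qed.

(** The head of a class belongs to no other class, which already separates the sets of lines. *)
Lemma dls_inj_classes : {in classes &, injective dls}.
Proof.
move=> s s' s_in s'_in eq_dls; apply/eqP.
have /allP/(_ _ s'_in)/implyP := allP classes_disjoint _ s_in; apply.
have s_h := allP classes_head _ s_in; have sM := allP classes_reduced _ s_in.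
have s'M := sub_allines (allP classes_reduced _ s'_in).
rewrite -(dl_in_dls _ s'M); last exact: (allP sM).
by rewrite -eq_dls in_dls; apply: map_f.
Qed.

Lemma card_classes : [seq #|dls s| | s <- classes] = [:: 6; 12; 16; 8; 24; 48; 16].
Proof.
rewrite -classes_sizes; apply/eq_in_map => s s_in; apply: card_dls.
  exact: sub_allines (allP classes_reduced _ s_in).
exact: (allP classes_uniq _ s_in).
Qed.

Lemma set_seq7 (T : finType) (a b c d e f g : T) :
  [set:: [:: a; b; c; d; e; f; g]] = [set a; b; c; d; e; f; g].
Proof. by apply/setP => x; rewrite !inE !orbA. Qed.

Theorem theorem5p4 :
  let L1 := RC_lines in
  let L2 := EnG2 in
  let L3 := Tr_lines :|: UnG2 in
  let L4 := IC_lines :|: [set Aline] :|: EA2 in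
  let L5 := UG_lines :|: UnG1 in
  let L6 := EA1 :|: EnG1 in
  let L7 := EA3 :|: EnG3 in
  [/\ line_orbits = [set L1; L2; L3; L4; L5; L6; L7],
      #|line_orbits| = 7%N &
      (#|L1| = 6%N /\ #|L2| = 12%N /\ #|L3| = 16%N /\ #|L4| = 8%N /\
       #|L5| = 24%N /\ #|L6| = 48%N /\ #|L7| = 16%N)].
Proof.
have -> : EnG2 = dls (sEn 12) by apply: sEnE.
have -> : EA1 :|: EnG1 = dls (sEA1 ++ sEn 24) by rewrite /EnG1 sEnE EA1E dlsU.
have -> : Tr_lines :|: UnG2 = dls (lselect mTr ++ sorb lUn2) by rewrite Tr_linesE UnG2E dlsU.
have -> : IC_lines :|: [set Aline] :|: EA2 = dls ((lselect mIC ++ [:: lA]) ++ sorb lEA2).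
  by rewrite IC_linesE AlineE -dls1 EA2E !dlsU.
have -> : UG_lines :|: UnG1 = dls (lselect mUG ++ sorb lUn1) by rewrite UG_linesE UnG1E dlsU.
have -> : EA3 :|: EnG3 = dls (sorb lEA3 ++ sorb lEn3) by rewrite EA3E EnG3E dlsU.
rewrite RC_linesE.
split.
- by rewrite line_orbitsE classesE !map_cons; apply: set_seq7.
- rewrite line_orbitsE cardsE (card_uniqP _); first by rewrite classesE.
  by rewrite (map_inj_in_uniq dls_inj_classes) uniq_classes.
have := card_classes; rewrite classesE !map_cons => -[c1 c2 c3 c4 c5 c6 c7].
exact: (conj c1 (conj c2 (conj c3 (conj c4 (conj c5 (conj c6 c7)))))).
Qed.
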